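(* Let $\ell\in\mathbb{N}=\{1,2,\dots\}$. Then for all $z,w\in\mathbb{C}$, $$\mathsf{K}_{\ell,T}(z,w)=e^{-\frac14(z-\overline{w})^2}\,L^0_{\ell-1}\left(\frac{|z-w|^2}{2}\right).$$
   Context: For $m,n\in\mathbb{N}_0$ the complex Itô–Hermite polynomials are $$H_{m,n}(z,\overline{z})=\sum_{j=0}^{\min(m,n)}(-1)^j j!\binom{m}{j}\binom{n}{j}z^{n-j}\,\overline{z}^{\,m-j}.$$ The polyanalytic extension of the convolution of normalized Hermite functions is $$(T_{m,p}\psi_n)(z):=\frac{1}{\sqrt{m!\,n!}}\,e^{-\frac{z^2}{4}}\,H_{m,n}\left(\frac{z}{\sqrt2},\frac{\overline{z}}{\sqrt2}\right),\quad z\in\mathbb{C},$$ which is polyanalytic of order $m+1$ (i.e. annihilated by $\partial_{\overline z}^{m+1}$). The true polyanalytic Gaussian RBF kernel of order $\ell\in\mathbb{N}$ is $$\mathsf{K}_{\ell,T}(z,w):=\sum_{n=0}^{\infty}(T_{\ell-1,p}\psi_n)(z)\,\overline{(T_{\ell-1,p}\psi_n)(w)},\quad z,w\in\mathbb{C}.$$ The generalized Laguerre polynomials are $L^\beta_k(x)=\sum_{j=0}^{k}(-1)^j\binom{k+\beta}{k-j}\frac{x^j}{j!}$. *)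

(* Defs.v *)
From Stdlib Require Import Reals Factorial.
From Coquelicot Require Import Coquelicot.

Open Scope C_scope.

(** The complex exponential, absent from Coquelicot: e^(x+iy) = e^x (cos y + i sin y). *)
Definition Cexp (z : C) : C :=
  ((exp (Re z) * cos (Im z))%R, (exp (Re z) * sin (Im z))%R).

(** Sum of a complex series. Meaningful only when the series converges:
    like [Series], it takes an unspecified value otherwise. *)
Definition CSeries (a : nat -> C) : C :=
  @iota C_CompleteNormedModule (fun s : C => @is_series C_AbsRing C_NormedModule a s).

(** H_{m,n}, as a polynomial in two independent variables: [z] and [zb] (for the
    conjugate). [Binomial.C] is the real-valued binomial coefficient;
    [sum_n f N] is f 0 + ... + f N. *)
Definition ItoHermite (m n : nat) (z zb : C) : C :=
  sum_n (fun j : nat =>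
           RtoC ((-1) ^ j * INR (fact j) * Binomial.C m j * Binomial.C n j)%R
           * z ^ (n - j) * zb ^ (m - j))
        (Nat.min m n).

(** (T_{m,p} psi_n)(z). *)
Definition Tpsi (m n : nat) (z : C) : C :=
  RtoC (1 / sqrt (INR (fact m) * INR (fact n)))%R
  * Cexp (- (z ^ 2 / RtoC 4))
  * ItoHermite m n (z / RtoC (sqrt 2)) (Cconj z / RtoC (sqrt 2)).

Definition kernel_term (l : nat) (z w : C) (n : nat) : C :=
  Tpsi (l - 1) n z * Cconj (Tpsi (l - 1) n w).

(** K_{l,T}(z,w), the true polyanalytic Gaussian RBF kernel of order l >= 1. *)
Definition true_poly_kernel (l : nat) (z w : C) : C :=
  CSeries (kernel_term l z w).

(** Binomial coefficient with real upper index: x (x-1) ... (x-k+1) / k!. *)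
Fixpoint gbinom (x : R) (k : nat) : R :=
  match k with
  | O => 1
  | S k' => (gbinom x k' * (x - INR k') / INR (S k'))%R
  end.

(** The generalized Laguerre polynomial L^beta_k(x). *)
Definition Laguerre (beta : R) (k : nat) (x : R) : R :=
  sum_n (fun j : nat =>
           ((-1) ^ j * gbinom (INR k + beta) (k - j) * (x ^ j / INR (fact j)))%R) k.

(* Main.v *)
Require Import Defs.
From Stdlib Require Import Reals Factorial Lra Lia.
From Coquelicot Require Import Coquelicot.

Open Scope C_scope.

(** The kernel identity is the case m = m' of a bilinear generating series valid
    for four independent complex variables:
    << sum_n H_{m,n}(a,b) H_{m',n}(c,d) / n!
         = (-1)^m e^(a c) H_{m,m'}(d - a, c - b). >>
    It is proved by induction on the two orders, without rearranging any
    multiple sum.  The Ito-Hermite polynomials satisfy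
    << H_{m+1,n} = zb H_{m,n} - n H_{m,n-1},
       H_{m,n+1} = z  H_{m,n} - m H_{m-1,n}, >>
    and the factor n in the first recurrence is absorbed by n!, so that the
    series with general term n H_{m,n-1}(a,b) H_{m',n}(c,d) / n! is a shift of the
    one with general term H_{m,n}(a,b) H_{m',n+1}(c,d) / n!, to which the second
    recurrence applies.  Calling S_{m,m'} the sum of the series, this gives
    << S_{m+1,m'} = (b - c) S_{m,m'} + m' S_{m,m'-1}, >>
    which up to the sign (-1)^m is the first recurrence again, at the point
    (d - a, c - b).  In the same way S_{0,m'+1} = (d - a) S_{0,m'}, and S_{0,0} is
    the exponential series of a c ([is_series_Cexp], by the differential equation
    of that series along a ray).  The convergence of every series comes along with its sum.

    The theorem follows by taking a, b, c, d to be z, its conjugate, the conjugate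
    of w, and w, all divided by the square root of 2.  The three exponents
    -z^2/4, -conj(w)^2/4 and z conj(w)/2 complete the square, and H_{m,m}
    depends on its arguments only through their product, here |z - w|^2/2: up to
    the factor (-1)^m m! it is a Laguerre polynomial ([ItoHermite_diag]). *)

(** * The complex exponential series *)

Lemma RtoC_neq_0 (x : R) : x <> 0%R -> RtoC x <> 0.
Proof. intros H E; apply H, RtoC_inj, E. Qed.

Definition exp_term (z : C) (n : nat) : C := z ^ n / RtoC (INR (fact n)).

Lemma is_series_C (f : nat -> C) (x y : R) :
  is_series (fun n => Re (f n)) x ->
  is_series (fun n => Im (f n)) y ->
  @is_series C_AbsRing C_NormedModule f (x, y).
Proof.
  intros Hx Hy.
  assert (Hsum : forall n, @sum_n C_AbelianMonoid f n
            = (sum_n (fun n => Re (f n)) n, sum_n (fun n => Im (f n)) n)).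
  { induction n as [|n IH].
    - rewrite !sum_O; destruct (f 0%nat); reflexivity.
    - rewrite !sum_Sn, IH; reflexivity. }
  apply filterlim_locally; intros eps.
  generalize (filter_and _ _ (proj1 (filterlim_locally _ _) Hx eps)
                (proj1 (filterlim_locally _ _) Hy eps)).
  apply filter_imp; intros n [H1 H2].
  refine (eq_ind_r (fun s : C_UniformSpace => ball ((x, y) : C_UniformSpace) eps s) _ (Hsum n)).
  split; assumption.
Qed.

(** The terms of the exponential series at [r * (Rabs x + 1)] are bounded, and
    they dominate the terms [a n * (Rabs x + 1) ^ n]; hence the radius of
    convergence is at least [Rabs x + 1]. *)
Lemma CV_radius_entire (a : nat -> R) (r x : R) :
  (0 <= r)%R ->
  (forall n, Rabs (a n) <= r ^ n / INR (fact n))%R ->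
  Rbar_lt (Rabs x) (CV_radius a).
Proof.
  intros Hr Ha.
  apply (Rbar_lt_le_trans _ (Rabs x + 1)%R); [simpl; lra|].
  apply (proj1 (CV_radius_bounded a)).
  set (q := (Rabs x + 1)%R).
  assert (Hx := Rabs_pos x).
  destruct (filterlim_bounded (fun n => / INR (fact n) * (r * q) ^ n)%R) as [M HM].
  { exists 0%R.
    apply (ex_series_lim_0 (fun n => / INR (fact n) * (r * q) ^ n)%R).
    exists (exp (r * q)); apply is_pseries_R, is_exp_Reals. }
  exists M; intros n.
  apply Rle_trans with (2 := HM n), Rle_trans with (2 := Rle_abs _).
  rewrite Rabs_mult, <- RPow_abs, (Rabs_right q), Rpow_mult_distr by (unfold q; lra).
  rewrite <- Rmult_assoc, (Rmult_comm (/ _)).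
  apply Rmult_le_compat_r; [apply pow_le; unfold q; lra | apply Ha].
Qed.

(** Along the ray [t * z], the real and imaginary parts of the exponential series
    are the real power series in [t] with the coefficients below; this makes the
    theory of real power series available. *)
Definition exp_re (z : C) (n : nat) : R := Re (exp_term z n).
Definition exp_im (z : C) (n : nat) : R := Im (exp_term z n).

Lemma exp_term_S (z : C) (n : nat) :
  RtoC (INR (S n)) * exp_term z (S n) = z * exp_term z n.
Proof.
  unfold exp_term; rewrite Cpow_S, fact_simpl, mult_INR, RtoC_mult.
  field; split; apply RtoC_neq_0; [apply INR_fact_neq_0 | apply not_0_INR; lia].
Qed.

Lemma Cmod_exp_term (z : C) (n : nat) : Cmod (exp_term z n) = (Cmod z ^ n / INR (fact n))%R.
Proof.
  assert (Hf := INR_fact_lt_0 n).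
  unfold exp_term; rewrite Cmod_div, Cmod_pow, Cmod_R, Rabs_right; try lra.
  apply RtoC_neq_0; lra.
Qed.

Lemma CV_radius_Re (z : C) (x : R) : Rbar_lt (Rabs x) (CV_radius (exp_re z)).
Proof.
  apply (CV_radius_entire _ (Cmod z)); [apply Cmod_ge_0|].
  intros n; rewrite <- Cmod_exp_term; apply re_le_Cmod.
Qed.

Lemma CV_radius_Im (z : C) (x : R) : Rbar_lt (Rabs x) (CV_radius (exp_im z)).
Proof.
  apply (CV_radius_entire _ (Cmod z)); [apply Cmod_ge_0|].
  intros n; rewrite <- Cmod_exp_term.
  eapply Rle_trans; [apply Rmax_r | apply Rmax_Cmod].
Qed.

(** By [exp_term_S], differentiating the series in t multiplies it by z; this is
    the real part of that fact. *)
Lemma is_derive_Re (z : C) (t : R) :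
  is_derive (PSeries (exp_re z)) t (Re z * PSeries (exp_re z) t - Im z * PSeries (exp_im z) t)%R.
Proof.
  rewrite <- !PSeries_scal, <- PSeries_minus
    by (apply @ex_pseries_scal; [apply Rmult_comm | apply CV_radius_inside];
        [apply CV_radius_Re || apply CV_radius_Im]).
  rewrite <- (PSeries_ext (PS_derive (exp_re z))).
  - apply is_derive_PSeries, CV_radius_Re.
  - intros n; assert (H := f_equal Re (exp_term_S z n)).
    unfold PS_derive, PS_minus, PS_scal, exp_re, exp_im.
    rewrite <- re_scal_l, H; reflexivity.
Qed.

Lemma is_derive_Im (z : C) (t : R) :
  is_derive (PSeries (exp_im z)) t (Re z * PSeries (exp_im z) t + Im z * PSeries (exp_re z) t)%R.
Proof.
  rewrite <- !PSeries_scal, <- PSeries_plus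
    by (apply @ex_pseries_scal; [apply Rmult_comm | apply CV_radius_inside];
        [apply CV_radius_Re || apply CV_radius_Im]).
  rewrite <- (PSeries_ext (PS_derive (exp_im z))).
  - apply is_derive_PSeries, CV_radius_Im.
  - intros n; assert (H := f_equal Im (exp_term_S z n)).
    unfold PS_derive, PS_plus, PS_scal, exp_re, exp_im.
    rewrite <- im_scal_l, H; reflexivity.
Qed.

(** Let E(t) be the sum of the series at [t * z], whose real and imaginary parts
    are the two power series below.  Then E' = z E, so e^(-t z) E(t) has
    derivative 0 and keeps its value 1 at t = 0.  The expression below is the
    real part of (p - i q) e^(-t z) E(t): its value at t = 1 is p. *)
Lemma rotated_series_const (z : C) (p q : R) :
  let g t := (exp (- (Re z * t)) *
     ((p * cos (Im z * t) - q * sin (Im z * t)) * PSeries (exp_re z) t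
    + (p * sin (Im z * t) + q * cos (Im z * t)) * PSeries (exp_im z) t))%R in
  g 1%R = p.
Proof.
  intros g.
  assert (Hg : g 0%R = g 1%R).
  { apply (eq_is_derive g); [|lra].
    intros t _; unfold g.
    assert (Ha := is_derive_Re z t); assert (Hb := is_derive_Im z t).
    auto_derive.
    - repeat split; eexists; eassumption.
    - rewrite (is_derive_unique (fun x : R => PSeries (exp_re z) x) _ _ Ha).
      rewrite (is_derive_unique (fun x : R => PSeries (exp_im z) x) _ _ Hb).
      unfold zero; simpl; ring. }
  rewrite <- Hg; unfold g.
  rewrite !PSeries_0, !Rmult_0_r, Ropp_0, exp_0, cos_0, sin_0.
  unfold exp_re, exp_im, exp_term; simpl; field.
Qed.

Lemma PSeries_exp (z : C) :
  PSeries (exp_re z) 1 = Re (Cexp z) /\ PSeries (exp_im z) 1 = Im (Cexp z).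
Proof.
  (* With (p, q) = (1, 0) and (0, 1), the real and imaginary parts of
     e^(-z) E(1) = 1, which are then solved for E(1). *)
  assert (H1 := rotated_series_const z 1 0).
  assert (H2 := rotated_series_const z 0 1).
  cbv beta zeta in H1, H2; rewrite !Rmult_1_r, exp_Ropp in H1, H2.
  unfold Cexp; simpl.
  assert (He := exp_pos (Re z)).
  set (A := PSeries (exp_re z) 1) in *; set (B := PSeries (exp_im z) 1) in *.
  set (u := cos (Im z)) in *; set (v := sin (Im z)) in *.
  assert (Huv : (v * v + u * u = 1)%R) by (apply (sin2_cos2 (Im z))).
  set (e := exp (Re z)) in *.
  assert (K1 : (u * A + v * B = e)%R).
  { apply (Rmult_eq_reg_l (/ e)); [|apply Rinv_neq_0_compat; lra].
    rewrite Rinv_l by lra; rewrite <- H1; ring. }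
  assert (K2 : (u * B - v * A = 0)%R).
  { apply (Rmult_eq_reg_l (/ e)); [|apply Rinv_neq_0_compat; lra].
    rewrite Rmult_0_r, <- H2; ring. }
  split.
  - transitivity ((v * v + u * u) * A)%R; [rewrite Huv; ring|].
    rewrite <- K1; transitivity (u * (u * A + v * B) - v * (u * B - v * A))%R; [ring|rewrite K2; ring].
  - transitivity ((v * v + u * u) * B)%R; [rewrite Huv; ring|].
    rewrite <- K1; transitivity (v * (u * A + v * B) + u * (u * B - v * A))%R; [ring|rewrite K2; ring].
Qed.

Lemma is_series_Cexp (z : C) : @is_series C_AbsRing C_NormedModule (exp_term z) (Cexp z).
Proof.
  destruct (PSeries_exp z) as [Ha Hb].
  rewrite (surjective_pairing (Cexp z)).
  change (fst (Cexp z)) with (Re (Cexp z)); change (snd (Cexp z)) with (Im (Cexp z)).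
  rewrite <- Ha, <- Hb.
  apply is_series_C.
  - apply (is_series_ext (fun n => exp_re z n * 1 ^ n)%R);
      [intros n; rewrite pow1; apply Rmult_1_r|].
    apply is_pseries_R, PSeries_correct, CV_radius_inside, CV_radius_Re.
  - apply (is_series_ext (fun n => exp_im z n * 1 ^ n)%R);
      [intros n; rewrite pow1; apply Rmult_1_r|].
    apply is_pseries_R, PSeries_correct, CV_radius_inside, CV_radius_Im.
Qed.

(** * Binomial coefficients with real upper index *)

Lemma gbinom_gt (n k : nat) : (n < k)%nat -> gbinom (INR n) k = 0%R.
Proof.
  induction 1 as [|k _ IH]; cbn [gbinom].
  - unfold Rdiv; rewrite Rminus_diag; ring.
  - rewrite IH; unfold Rdiv; ring.
Qed.

Lemma gbinom_fact (n k : nat) : (k <= n)%nat ->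
  (gbinom (INR n) k * (INR (fact k) * INR (fact (n - k))) = INR (fact n))%R.
Proof.
  induction k as [|k IH]; intros H.
  - rewrite Nat.sub_0_r; simpl; ring.
  - rewrite <- IH by lia.
    replace (n - k)%nat with (S (n - S k)) by lia.
    rewrite !fact_simpl, !mult_INR.
    replace (INR (S (n - S k))) with (INR n - INR k)%R
      by (rewrite <- minus_INR by lia; f_equal; lia).
    cbn [gbinom]; field; apply not_0_INR; lia.
Qed.

Lemma gbinom_C (n k : nat) : (k <= n)%nat -> Binomial.C n k = gbinom (INR n) k.
Proof.
  intros H; unfold Binomial.C; rewrite <- (gbinom_fact n k H).
  field; split; apply INR_fact_neq_0.
Qed.

Lemma gbinom_absorption (x : R) (k : nat) :
  (INR (S k) * gbinom (x + 1) (S k) = (x + 1) * gbinom x k)%R.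
Proof.
  induction k as [|k IH]; [simpl; field|].
  assert (Hk : INR (S k) <> 0%R) by (apply not_0_INR; lia).
  assert (Hk' : INR (S (S k)) <> 0%R) by (apply not_0_INR; lia).
  transitivity (gbinom (x + 1) (S k) * (x + 1 - INR (S k)))%R.
  { cbn [gbinom]; field; auto. }
  transitivity (INR (S k) * gbinom (x + 1) (S k) * (x - INR k) / INR (S k))%R.
  { rewrite S_INR in *; field; auto. }
  rewrite IH; cbn [gbinom]; field; auto.
Qed.

Lemma gbinom_pascal (x : R) (k : nat) :
  gbinom (x + 1) (S k) = (gbinom x (S k) + gbinom x k)%R.
Proof.
  assert (Hk : INR (S k) <> 0%R) by (apply not_0_INR; lia).
  apply (Rmult_eq_reg_l (INR (S k))); [|exact Hk].
  rewrite gbinom_absorption; cbn [gbinom]; rewrite S_INR in *; field; exact Hk.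
Qed.

(** * Recurrences of the Ito-Hermite polynomials *)

(** [gbinom] instead of [Binomial.C]: it vanishes when the lower index exceeds the
    upper one, whereas [Binomial.C n j] = n! / j! for j > n since the subtraction
    n - j is truncated.  The vanishing lets the sum run to any bound above
    min(m, n), so that sums for different m and n can be compared. *)
Definition hermite_term (m n : nat) (z zb : C) (j : nat) : C :=
  RtoC ((-1) ^ j * INR (fact j) * gbinom (INR m) j * gbinom (INR n) j)
  * z ^ (n - j) * zb ^ (m - j).

(** Finite sums are stated in an abstract monoid; [ring] needs the equation and
    the additions to be visibly those of [C]. *)
Ltac eq_in_C :=
  match goal with |- @eq _ ?x ?y => change (@eq C x y) end;
  repeat change (@plus ?G ?x ?y) with (Cplus x y).

Lemma hermite_term_gt (m n : nat) (z zb : C) (j : nat) :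
  (Nat.min m n < j)%nat -> hermite_term m n z zb j = 0.
Proof.
  intros H; unfold hermite_term.
  destruct (Nat.lt_ge_cases m j) as [Hm|Hm].
  - rewrite (gbinom_gt m) by exact Hm. rewrite Rmult_0_r, Rmult_0_l; ring.
  - rewrite (gbinom_gt n) by lia. rewrite Rmult_0_r; ring.
Qed.

Lemma ItoHermite_sum (m n : nat) (z zb : C) (N : nat) :
  (Nat.min m n <= N)%nat ->
  ItoHermite m n z zb = sum_n (hermite_term m n z zb) N.
Proof.
  induction 1 as [|N HN IH].
  - apply sum_n_ext_loc; intros j Hj; unfold hermite_term.
    rewrite !gbinom_C by lia; reflexivity.
  - rewrite sum_Sn, <- IH, hermite_term_gt by lia.
    symmetry; apply (plus_zero_r (G := C_AbelianGroup)).
Qed.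

Lemma ItoHermite_sym (m n : nat) (z zb : C) :
  ItoHermite m n z zb = ItoHermite n m zb z.
Proof.
  rewrite (ItoHermite_sum m n _ _ (Nat.min m n)), (ItoHermite_sum n m _ _ (Nat.min m n)) by lia.
  apply sum_n_ext; intros j; unfold hermite_term.
  rewrite !RtoC_mult; eq_in_C; ring.
Qed.

Lemma ItoHermite_0_l (n : nat) (z zb : C) : ItoHermite 0 n z zb = z ^ n.
Proof.
  rewrite (ItoHermite_sum 0 n _ _ 0) by lia.
  rewrite sum_O; unfold hermite_term; simpl fact; cbn [gbinom pow Nat.sub Cpow INR].
  rewrite Nat.sub_0_r, !Rmult_1_r; ring.
Qed.

(** Pascal's rule in m splits the left side.  Its first part is zb times the term
    of the same index; in the second, the absorption identity
    (j + 1) C(n, j + 1) = n C(n - 1, j) produces the factor n and lowers the index. *)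
Lemma hermite_term_pascal (m n j : nat) (z zb : C) :
  hermite_term (S m) n z zb (S j) =
  zb * hermite_term m n z zb (S j)
  - RtoC (INR n) * hermite_term m (n - 1) z zb j.
Proof.
  assert (Habs : (INR (S j) * gbinom (INR n) (S j) = INR n * gbinom (INR (n - 1)) j)%R).
  { destruct n as [|n].
    - rewrite gbinom_gt by lia; simpl; ring.
    - rewrite (S_INR n), gbinom_absorption; simpl Nat.sub; rewrite Nat.sub_0_r; reflexivity. }
  (* m - (j + 1) is truncated only for j >= m, where the binomial vanishes. *)
  assert (Hpow : RtoC (gbinom (INR m) (S j)) * (zb * zb ^ (m - S j))
                 = RtoC (gbinom (INR m) (S j)) * zb ^ (m - j)).
  { destruct (Nat.lt_ge_cases j m) as [H|H].
    - replace (m - j)%nat with (S (m - S j)) by lia; rewrite Cpow_S; reflexivity.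
    - rewrite gbinom_gt by lia; ring. }
  unfold hermite_term.
  replace (S m - S j)%nat with (m - j)%nat by lia.
  replace (n - 1 - j)%nat with (n - S j)%nat by lia.
  rewrite (S_INR m), gbinom_pascal, fact_simpl, mult_INR.
  apply (f_equal RtoC) in Habs; rewrite !RtoC_mult in Habs.
  rewrite !RtoC_mult, RtoC_plus.
  transitivity (RtoC ((-1) ^ S j) * RtoC (INR (fact j)) *
     (RtoC (INR (S j)) * RtoC (gbinom (INR n) (S j))) * z ^ (n - S j) *
     (RtoC (gbinom (INR m) (S j)) * zb ^ (m - j) + RtoC (gbinom (INR m) j) * zb ^ (m - j))); [ring|].
  rewrite <- Hpow.
  transitivity (zb * (RtoC ((-1) ^ S j) * RtoC (INR (fact j)) * (RtoC (INR (S j)) * RtoC (gbinom (INR n) (S j)))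
      * z ^ (n - S j) * RtoC (gbinom (INR m) (S j)) * zb ^ (m - S j)) +
      RtoC ((-1) ^ S j) * RtoC (INR (fact j)) * (RtoC (INR (S j)) * RtoC (gbinom (INR n) (S j))) * z ^ (n - S j) *
      RtoC (gbinom (INR m) j) * zb ^ (m - j)); [ring|].
  rewrite Habs at 2.
  replace (RtoC ((-1) ^ S j)) with (- RtoC ((-1) ^ j)) by (rewrite <- RtoC_opp; f_equal; simpl; ring).
  ring.
Qed.

Lemma sum_hermite_term_pascal (m n N : nat) (z zb : C) :
  sum_n (hermite_term (S m) n z zb) (S N) =
  zb * sum_n (hermite_term m n z zb) (S N)
  - RtoC (INR n) * sum_n (hermite_term m (n - 1) z zb) N.
Proof.
  induction N as [|N IH].
  - rewrite !sum_Sn, !sum_O, hermite_term_pascal.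
    unfold hermite_term at 1 4; rewrite !Nat.sub_0_r, Cpow_S; cbn [gbinom].
    eq_in_C; ring.
  - rewrite (sum_Sn _ (S N)), IH, hermite_term_pascal.
    rewrite (sum_Sn _ (S N)), (sum_Sn (hermite_term m (n - 1) z zb) N).
    eq_in_C; ring.
Qed.

(** At [n = 0] the truncated [n - 1] is harmless, as its coefficient is 0. *)
Lemma ItoHermite_S_l (m n : nat) (z zb : C) :
  ItoHermite (S m) n z zb =
  zb * ItoHermite m n z zb - RtoC (INR n) * ItoHermite m (n - 1) z zb.
Proof.
  rewrite (ItoHermite_sum m (n - 1) _ _ m) by lia.
  rewrite (ItoHermite_sum m n _ _ (S m)), (ItoHermite_sum (S m) n _ _ (S m)) by lia.
  apply sum_hermite_term_pascal.
Qed.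

Lemma ItoHermite_S_r (m n : nat) (z zb : C) :
  ItoHermite m (S n) z zb =
  z * ItoHermite m n z zb - RtoC (INR m) * ItoHermite (m - 1) n z zb.
Proof.
  rewrite (ItoHermite_sym m (S n)), ItoHermite_S_l.
  rewrite (ItoHermite_sym n m), (ItoHermite_sym n (m - 1)); reflexivity.
Qed.

(** * The bilinear generating series *)

(** The factor n cancels against n!, and the new term of index 0 is 0. *)
Lemma is_series_shift (f g : nat -> C) (s : C) :
  @is_series C_AbsRing C_NormedModule
    (fun n => f n * g (S n) / RtoC (INR (fact n))) s ->
  @is_series C_AbsRing C_NormedModule
    (fun n => RtoC (INR n) * f (n - 1)%nat * g n / RtoC (INR (fact n))) s.
Proof.
  intros H; apply is_series_decr_1.
  replace (plus s _) with s.
  2:{ transitivity (s + - (RtoC 0 * f 0%nat * g 0%nat / RtoC (INR (fact 0)))); [|reflexivity].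
      unfold Cdiv; ring. }
  eapply is_series_ext; [|exact H].
  intros n; simpl Nat.sub; rewrite Nat.sub_0_r, fact_simpl, mult_INR, RtoC_mult.
  eq_in_C; field; split; apply RtoC_neq_0; [apply INR_fact_neq_0 | apply not_0_INR; lia].
Qed.

Lemma is_series_lincomb (f g h : nat -> C) (k s t l : C) :
  @is_series C_AbsRing C_NormedModule f s ->
  @is_series C_AbsRing C_NormedModule g t ->
  (forall n, h n = k * f n - g n) -> l = k * s - t ->
  @is_series C_AbsRing C_NormedModule h l.
Proof.
  intros Hf Hg Hh ->.
  apply (is_series_ext _ _ _ (fun n => eq_sym (Hh n))).
  apply (is_series_minus (K := C_AbsRing) (V := C_NormedModule)); [|exact Hg].
  apply (is_series_scal (K := C_AbsRing) (V := C_NormedModule)); exact Hf.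
Qed.

Definition bilinear_term (m m' : nat) (a b c d : C) (n : nat) : C :=
  ItoHermite m n a b * ItoHermite m' n c d / RtoC (INR (fact n)).

(** For the orders (m + 1, m'), the first recurrence in m is applied to the left
    factor, the resulting n is removed by a shift, and the right factor, now of
    index n + 1, is expanded by the second recurrence.  For (0, m' + 1) the two
    factors exchange their roles.  In both cases the value obtained is the
    recurrence for H_{m,m'} at (d - a, c - b). *)
Lemma bilinear_generating_series (m m' : nat) (a b c d : C) :
  @is_series C_AbsRing C_NormedModule (bilinear_term m m' a b c d)
    (RtoC ((-1) ^ m) * Cexp (a * c) * ItoHermite m m' (d - a) (c - b)).
Proof.
  revert m'; induction m as [|m IHm].
  - induction m' as [|m' IHm'].
    + rewrite ItoHermite_0_l.
      replace (_ * _ * _) with (Cexp (a * c)) by (simpl; ring).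
      eapply is_series_ext; [|apply is_series_Cexp].
      intros n; unfold exp_term, bilinear_term.
      rewrite !ItoHermite_0_l, Cpow_mult_l; reflexivity.
    + eapply (is_series_lincomb (bilinear_term 0 m' a b c d)
        (fun n => RtoC (INR n) * ItoHermite m' (n - 1) c d * ItoHermite 0 n a b / RtoC (INR (fact n)))
        _ d _ (a * (RtoC ((-1) ^ 0) * Cexp (a * c) * ItoHermite 0 m' (d - a) (c - b)))); [exact IHm'| | |].
      * apply (is_series_shift (fun n => ItoHermite m' n c d) (fun n => ItoHermite 0 n a b)).
        eapply is_series_ext; [|apply (is_series_scal (K := C_AbsRing) (V := C_NormedModule)), IHm'].
        intros n; unfold bilinear_term; rewrite ItoHermite_S_r.
        change (scal a ?x) with (a * x); unfold Cdiv; simpl INR.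
        eq_in_C; ring.
      * intros n; unfold bilinear_term; rewrite (ItoHermite_S_l m'); unfold Cdiv; ring.
      * rewrite ItoHermite_S_r; simpl INR; ring.
  - intros m'.
    eapply (is_series_lincomb (bilinear_term m m' a b c d)
        (fun n => RtoC (INR n) * ItoHermite m (n - 1) a b * ItoHermite m' n c d / RtoC (INR (fact n)))
        _ b _ (c * (RtoC ((-1) ^ m) * Cexp (a * c) * ItoHermite m m' (d - a) (c - b))
          - RtoC (INR m') * (RtoC ((-1) ^ m) * Cexp (a * c) * ItoHermite m (m' - 1) (d - a) (c - b)))); [apply IHm| | |].
    + apply (is_series_shift (fun n => ItoHermite m n a b) (fun n => ItoHermite m' n c d)).
      refine (is_series_lincomb _ _ _ c _ _ _ (IHm m')
        (is_series_scal (K := C_AbsRing) (V := C_NormedModule) (RtoC (INR m')) _ _ (IHm (m' - 1)%nat)) _ (eq_refl _)).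
      intros n; unfold bilinear_term; rewrite ItoHermite_S_r.
      change (scal (RtoC (INR m')) ?x) with (RtoC (INR m') * x); unfold Cdiv; ring.
    + intros n; unfold bilinear_term; rewrite (ItoHermite_S_l m); unfold Cdiv; ring.
    + rewrite ItoHermite_S_l; change ((-1) ^ S m)%R with (-1 * (-1) ^ m)%R.
      rewrite RtoC_mult; ring.
Qed.

(** * Diagonal polynomials and Laguerre polynomials *)

Lemma sum_n_rev {G : AbelianMonoid} (f : nat -> G) (N : nat) :
  sum_n f N = sum_n (fun j => f (N - j)%nat) N.
Proof.
  induction N as [|N IH]; [rewrite !sum_O; reflexivity|].
  rewrite sum_Sn, IH; unfold sum_n at 2; rewrite sum_Sn_m by lia.
  rewrite <- sum_n_m_S, plus_comm; reflexivity.
Qed.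

Lemma RtoC_sum_n (f : nat -> R) (N : nat) :
  RtoC (sum_n f N) = sum_n (fun j => RtoC (f j)) N.
Proof.
  induction N as [|N IH]; [rewrite !sum_O; reflexivity|].
  rewrite !sum_Sn, <- IH; apply RtoC_plus.
Qed.

(** Substituting p = m - j for the summation index, the coefficient of x^p on the
    left is (-1)^p (m - p)! C(m, m - p)^2 = m! (-1)^p C(m, m - p) / p!. *)
Lemma ItoHermite_diag (m : nat) (z zb : C) (x : R) :
  z * zb = RtoC x ->
  RtoC ((-1) ^ m) * ItoHermite m m z zb = RtoC (INR (fact m) * Laguerre 0 m x).
Proof.
  intros Hx.
  unfold Laguerre; rewrite (ItoHermite_sum m m z zb m), sum_n_rev by lia.
  rewrite RtoC_mult, RtoC_sum_n.
  rewrite <- !(sum_n_mult_l (K := C_Ring)).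
  apply sum_n_ext_loc; intros p Hp; unfold hermite_term.
  change (@mult C_Ring ?u ?v) with (Cmult u v).
  replace (m - (m - p))%nat with p by lia.
  eq_in_C; rewrite <- Cmult_assoc, <- Cpow_mult_l, Hx, <- RtoC_pow, <- !RtoC_mult.
  f_equal; rewrite Rplus_0_r.
  assert (Hm : ((-1) ^ m = (-1) ^ p * (-1) ^ (m - p))%R) by (rewrite <- pow_add; f_equal; lia).
  assert (Hs : ((-1) ^ (m - p) * (-1) ^ (m - p) = 1)%R)
    by (rewrite <- Rpow_mult_distr; replace (-1 * -1)%R with 1%R by ring; apply pow1).
  rewrite Hm, <- (gbinom_fact m (m - p)) by lia.
  replace (m - (m - p))%nat with p by lia.
  transitivity (((-1) ^ (m - p) * (-1) ^ (m - p)) * ((-1) ^ p * INR (fact (m - p)) *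
     gbinom (INR m) (m - p) * gbinom (INR m) (m - p) * x ^ p))%R; [ring|].
  rewrite Hs; field; apply INR_fact_neq_0.
Qed.

(** * The kernel *)

Lemma Cconj_RtoC (x : R) : Cconj (RtoC x) = RtoC x.
Proof. unfold Cconj, RtoC; simpl; f_equal; ring. Qed.

Lemma Cconj_ItoHermite (m n : nat) (z zb : C) :
  Cconj (ItoHermite m n z zb) = ItoHermite m n (Cconj z) (Cconj zb).
Proof.
  unfold ItoHermite; generalize (Nat.min m n); intros N.
  induction N as [|N IH].
  - rewrite !sum_O, !Cmult_conj, !Cpow_conj, Cconj_RtoC; reflexivity.
  - rewrite !sum_Sn, <- IH.
    etransitivity; [apply Cplus_conj|]; f_equal.
    rewrite !Cmult_conj, !Cpow_conj, Cconj_RtoC; reflexivity.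
Qed.

Lemma Cexp_plus (u v : C) : Cexp (u + v) = Cexp u * Cexp v.
Proof.
  destruct u, v; unfold Cexp, Cmult; simpl; rewrite exp_plus, cos_plus, sin_plus.
  f_equal; ring.
Qed.

Lemma Cconj_Cexp (u : C) : Cconj (Cexp u) = Cexp (Cconj u).
Proof.
  destruct u; unfold Cexp, Cconj; simpl; rewrite cos_neg, sin_neg; f_equal; ring.
Qed.

(** Conjugation conjugates both arguments of H, so the factor in w becomes a value
    of H at (conj w, w), up to scaling: the conjugate outside has disappeared, and
    the two factors are values of polynomials in four independent variables. *)
Lemma kernel_term_bilinear (l : nat) (z w : C) (n : nat) :
  let s := RtoC (sqrt 2) in
  kernel_term l z w n =
  (Cexp (- (z ^ 2 / RtoC 4)) * Cexp (- (Cconj w ^ 2 / RtoC 4)) / RtoC (INR (fact (l - 1))))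
  * bilinear_term (l - 1) (l - 1) (z / s) (Cconj z / s) (Cconj w / s) (w / s) n.
Proof.
  intros s; unfold kernel_term, Tpsi, bilinear_term.
  assert (Hs : s <> RtoC 0).
  { apply RtoC_neq_0; assert (H := sqrt_lt_R0 2); lra. }
  assert (Hm := INR_fact_lt_0 (l - 1)); assert (Hn := INR_fact_lt_0 n).
  assert (H4 : RtoC 4 <> 0) by (apply RtoC_neq_0; lra).
  rewrite !Cmult_conj, Cconj_RtoC, Cconj_ItoHermite, Cconj_Cexp, Copp_conj.
  rewrite !Cdiv_conj, Cpow_conj, Cconj_conj, !Cconj_RtoC by assumption.
  fold s.
  assert (Hr : RtoC (1 / sqrt (INR (fact (l - 1)) * INR (fact n)))
             * RtoC (1 / sqrt (INR (fact (l - 1)) * INR (fact n)))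
             = / RtoC (INR (fact (l - 1))) * / RtoC (INR (fact n))).
  { rewrite <- !RtoC_inv, <- !RtoC_mult by lra; f_equal.
    assert (Hp : (0 < INR (fact (l - 1)) * INR (fact n))%R) by (apply Rmult_lt_0_compat; lra).
    assert (Hq := sqrt_lt_R0 _ Hp).
    rewrite <- Rinv_mult; rewrite <- (sqrt_sqrt _ (Rlt_le _ _ Hp)) at 3.
    field; lra. }
  transitivity (RtoC (1 / sqrt (INR (fact (l - 1)) * INR (fact n)))
             * RtoC (1 / sqrt (INR (fact (l - 1)) * INR (fact n)))
     * (Cexp (- (z ^ 2 / RtoC 4)) * Cexp (- (Cconj w ^ 2 / RtoC 4))
     * (ItoHermite (l - 1) n (z / s) (Cconj z / s) * ItoHermite (l - 1) n (Cconj w / s) (w / s)))); [ring|].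
  rewrite Hr; unfold Cdiv; ring.
Qed.

Lemma is_series_kernel (l : nat) (z w : C) :
  @is_series C_AbsRing C_NormedModule (kernel_term l z w)
    (Cexp (RtoC (- (1 / 4)) * (z - Cconj w) ^ 2)
      * RtoC (Laguerre 0 (l - 1) (Cmod (z - w) ^ 2 / 2))).
Proof.
  set (s := RtoC (sqrt 2)); set (m := (l - 1)%nat).
  assert (Hss : s * s = RtoC 2) by (unfold s; rewrite <- RtoC_mult, sqrt_sqrt by lra; reflexivity).
  assert (Hs : s <> 0).
  { apply RtoC_neq_0; assert (H := sqrt_lt_R0 2); lra. }
  assert (Hf : RtoC (INR (fact m)) <> 0) by apply RtoC_neq_0, INR_fact_neq_0.
  assert (H2 : RtoC 2 <> 0) by (apply RtoC_neq_0; lra).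
  assert (H4 : RtoC 4 = RtoC 2 * RtoC 2) by (rewrite <- RtoC_mult; f_equal; ring).
  assert (HL := ItoHermite_diag m (w / s - z / s) (Cconj w / s - Cconj z / s) (Cmod (z - w) ^ 2 / 2)).
  rewrite RtoC_div, Cmod2_conj, Cminus_conj in HL by lra.
  apply (is_series_ext _ _ _ (fun n => eq_sym (kernel_term_bilinear l z w n))).
  replace (Cexp _ * RtoC _) with
    ((Cexp (- (z ^ 2 / RtoC 4)) * Cexp (- (Cconj w ^ 2 / RtoC 4)) / RtoC (INR (fact m)))
     * (RtoC ((-1) ^ m) * Cexp (z / s * (Cconj w / s))
        * ItoHermite m m (w / s - z / s) (Cconj w / s - Cconj z / s))).
  { apply (is_series_scal (K := C_AbsRing) (V := C_NormedModule)), bilinear_generating_series. }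
  assert (HE : Cexp (RtoC (- (1 / 4)) * (z - Cconj w) ^ 2)
     = Cexp (- (z ^ 2 / RtoC 4)) * Cexp (- (Cconj w ^ 2 / RtoC 4)) * Cexp (z / s * (Cconj w / s))).
  { rewrite <- !Cexp_plus; f_equal.
    replace (z / s * (Cconj w / s)) with (z * Cconj w / (s * s)) by (field; exact Hs).
    rewrite Hss, RtoC_opp, RtoC_div, H4 by lra; field; exact H2. }
  rewrite HE.
  transitivity (Cexp (- (z ^ 2 / RtoC 4)) * Cexp (- (Cconj w ^ 2 / RtoC 4)) * Cexp (z / s * (Cconj w / s))
    / RtoC (INR (fact m)) * (RtoC ((-1) ^ m) * ItoHermite m m (w / s - z / s) (Cconj w / s - Cconj z / s)));
    [unfold Cdiv; ring|].
  rewrite HL, RtoC_mult; [field; exact Hf|].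
  rewrite <- Hss; field; exact Hs.
Qed.

Theorem proposition4p7 (l : nat) (hl : (1 <= l)%nat) (z w : C) :
  @ex_series C_AbsRing C_NormedModule (kernel_term l z w) /\
  true_poly_kernel l z w
    = Cexp (RtoC (- (1 / 4)) * (z - Cconj w) ^ 2)
      * RtoC (Laguerre 0 (l - 1) (Cmod (z - w) ^ 2 / 2)).
Proof.
  assert (H := is_series_kernel l z w).
  split; [eexists; exact H|].
  apply (iota_filterlim_locally (K := C_AbsRing) (V := C_CompleteNormedModule)), H.
Qed.
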